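(* Let $f(x)=\min\{f_1(x),f_2(x)\}$ for $x\in\{0,1\}^n$, where $f_1(x)=a^\intercal x$ for some $a\in\mathbb{R}^n$, and $f_2:\{0,1\}^n\to\mathbb{R}\cup\{+\infty\}$ is submodular (and finite) on a lattice family $L\subseteq\{0,1\}^n$ with $f_2(x)=+\infty$ for $x\notin L$. Let $X:=L\cup\{e_i\mid i\in[n]\}$ and define $g:X\to\mathbb{R}$ by $$g(x)=\begin{cases}\min\{f_1(x),f_2(x)\}&\text{if }x\in\{e_i\mid i\in[n]\},\\ f_2(x)&\text{otherwise.}\end{cases}$$ For a given $\bar x\in\mathbb{R}^n_+$, let $\sigma$ be a permutation of $[n]$ sorting $\bar x$ in non-increasing order, $\bar x_{\sigma(1)}\ge\dots\ge\bar x_{\sigma(n)}$. Let $v_0^\sigma=\mathbf 0$, $v_i^\sigma=v_{i-1}^\sigma+e_{\sigma(i)}$, and define $\mu\in\mathbb{R}^n$ recursively by $\beta^0=\mathbf 0$ and, for $t=1,\dots,n$, $$\mu_{\sigma(t)}:=\min_{y\in\{0,1\}^n}\bigl\{g(e_{\sigma(t)}+y)-\langle\beta^{t-1},y\rangle\ \bigm|\ y\le v^\sigma_{t-1},\ e_{\sigma(t)}+y\in X\bigr\},\qquad \beta^t:=\beta^{t-1}+\mu_{\sigma(t)}e_{\sigma(t)}.$$ Then $\operatorname{sconv}(f)(\bar x)=\langle\mu,\bar x\rangle$, and $\mu$ can be computed by solving these $n$ minimization problems, each of which is a submodular minimization problem over a lattice family.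
   Context: $[n]=\{1,\dots,n\}$; $\vee,\wedge$ are componentwise max and min; $e_i$ is the $i$-th standard basis vector. A lattice family is a subset of $\{0,1\}^n$ closed under $\vee,\wedge$; $h$ is submodular on a lattice family if $h(x)+h(y)\ge h(x\vee y)+h(x\wedge y)$ for all $x,y$ in it. A function $p$ on a convex cone is sublinear if $p(rx)=rp(x)$ for $r\ge 0$ and $p(x+y)\le p(x)+p(y)$. For $f:S\subseteq\mathbb{R}^n\to\mathbb{R}$, the sublinear envelope $\operatorname{sconv}(f)$ is the largest sublinear function on $\operatorname{cone}(S)$ (convex conic hull) that is $\le f$ on $S$. Standing assumption: sublinear envelopes are considered for functions $f$ that admit a linear function $l$ with $l(x)\le f(x)$ for all $x\in S$ (here this amounts to $f_2(\mathbf 0)\ge 0$ if $\mathbf 0\in L$). *)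

(* Defs.v *)
From HB Require Import structures.
From mathcomp Require Import all_boot all_order all_algebra all_fingroup.
From mathcomp Require Import all_classical all_reals.
Set Implicit Arguments.
Unset Strict Implicit.
Unset Printing Implicit Defensive.
Import Order.TTheory GRing.Theory Num.Theory.
Local Open Scope classical_set_scope.
Local Open Scope ring_scope.

Section Defs.
Context {R : realType} {n : nat}.
Notation V := 'rV[R]_n.
Implicit Types (x y u v : V) (S K : set V) (f p q : V -> R).

Definition dot u v : R := \sum_(i < n) u 0 i * v 0 i.

Definition unitvec (i : 'I_n) : V := delta_mx 0 i.

Definition vle u v : Prop := forall i, u 0 i <= v 0 i.

Definition vjoin u v : V := \row_i Num.max (u 0 i) (v 0 i).

Definition vmeet u v : V := \row_i Num.min (u 0 i) (v 0 i).

Definition cube : set V := [set x | forall i, x 0 i = 0 \/ x 0 i = 1].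

Definition lattice_family (L : set V) : Prop :=
  L `<=` cube /\ forall x y, L x -> L y -> L (vjoin x y) /\ L (vmeet x y).

Definition submodular_on (L : set V) (h : V -> \bar R) : Prop :=
  forall x y, L x -> L y -> (h (vjoin x y) + h (vmeet x y) <= h x + h y)%E.

(* The case k = 0 puts the origin in every conic hull. *)
Definition cone S : set V :=
  [set x | exists (k : nat) (c : 'I_k -> R) (s : 'I_k -> V),
     [/\ forall i, 0 <= c i, forall i, S (s i) & x = \sum_(i < k) c i *: s i]].

Definition sublinear_on K p : Prop :=
  (forall (r : R) x, 0 <= r -> K x -> p (r *: x) = r * p x) /\
  (forall x y, K x -> K y -> p (x + y) <= p x + p y).

Definition sublinear_minorant S f p : Prop :=
  sublinear_on (cone S) p /\ forall x, S x -> p x <= f x.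

Definition is_sublinear_envelope S f p : Prop :=
  sublinear_minorant S f p /\
  forall q, sublinear_minorant S f q -> forall x, cone S x -> q x <= p x.

(* Envelopes are functions on [cone S] represented by total functions: only the
   values of [sconv S f] on [cone S] are meaningful, and these do not depend on
   the choice made by [xget], see [sublinear_envelope_unique]. *)
Definition sconv S f : V -> R := xget (cst 0) (is_sublinear_envelope S f).

Definition has_linear_minorant S f : Prop :=
  exists l : {scalar V}, forall x, S x -> l x <= f x.

Definition is_minimum (A : set R) (m : R) : Prop := A m /\ lbound A m.

Definition minimum (A : set R) : R := xget 0 (is_minimum A).

Section MinOfTwo.
Variables (a : V) (f2 : V -> \bar R) (L : set V).

(* [fine] only strips the [\bar R] wrapper: both minima and, on [L], the values
   of [f2] are finite under the hypotheses on [f2]. *)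
Definition minf x : R := fine (Order.min (dot a x)%:E (f2 x)).

Definition Xset : set V := L `|` range unitvec.

Definition gfun x : R :=
  if [exists i, x == unitvec i] then fine (Order.min (dot a x)%:E (f2 x))
  else fine (f2 x).

End MinOfTwo.

(* Positions are numbered from 0: for [t : 'I_n], step [t] below determines the
   coordinate [sigma t] using [vsig t] and [beta t], which only involve the
   positions strictly before [t]. *)
Section Greedy.
Variables (X : set V) (g : V -> R) (sigma : {perm 'I_n}).

Fixpoint vsig (t : nat) : V :=
  if t is t'.+1 then
    vsig t' + (if insub t' is Some i then unitvec (sigma i) else 0)
  else 0.

Definition feasible (t : 'I_n) : set V :=
  [set y | [/\ cube y, vle y (vsig t) & X (unitvec (sigma t) + y)]].

Definition objective (t : 'I_n) (b : V) (y : V) : R :=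
  g (unitvec (sigma t) + y) - dot b y.

Definition step_min (t : 'I_n) (b : V) : R :=
  minimum [set objective t b y | y in feasible t].

Fixpoint beta (t : nat) : V :=
  if t is t'.+1 then
    beta t' + (if insub t' is Some i
               then step_min i (beta t') *: unitvec (sigma i) else 0)
  else 0.

Definition mu : V :=
  \row_j step_min ((sigma^-1)%g j) (beta ((sigma^-1)%g j)).

End Greedy.

Lemma sub_cone S : S `<=` cone S.
Proof.
move=> x Sx; exists 1%N, (fun=> 1), (fun=> x); split=> //.
by rewrite big_ord1 scale1r.
Qed.

Lemma coneZ S (r : R) x : 0 <= r -> cone S x -> cone S (r *: x).
Proof.
move=> r0 [k [c [s [c0 Ss ->]]]]; exists k, (fun i => r * c i), s; split=> //.
  by move=> i; rewrite mulr_ge0.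
by rewrite scaler_sumr; apply: eq_bigr => i _; rewrite scalerA.
Qed.

Lemma coneD S x y : cone S x -> cone S y -> cone S (x + y).
Proof.
move=> [k [c [s [c0 Ss ->]]]] [m [d [w [d0 Sw ->]]]].
exists (k + m)%N,
  (fun i => match fintype.split i with inl j => c j | inr j => d j end),
  (fun i => match fintype.split i with inl j => s j | inr j => w j end); split.
- by move=> i; case: fintype.split.
- by move=> i; case: fintype.split.
rewrite big_split_ord /=; congr (_ + _); apply: eq_bigr => i _.
  by rewrite -[lshift m i]/(unsplit (inl i)) unsplitK.
by rewrite -[rshift k i]/(unsplit (inr i)) unsplitK.
Qed.

Lemma sublinear_envelope_unique S f p q :
  is_sublinear_envelope S f p -> is_sublinear_envelope S f q ->
  forall x, cone S x -> p x = q x.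
Proof.
move=> [pm pmax] [qm qmax] x Kx; apply/eqP; rewrite eq_le.
by rewrite (qmax p) // (pmax q).
Qed.

Lemma sublinear_minorant_bounded S f x : cone S x ->
  exists b, forall p, sublinear_minorant S f p -> p x <= b.
Proof.
move=> [k [c [s [c0 Ss ->]]]]; exists (\sum_(i < k) c i * f (s i)).
move=> p [[pZ pD] pf].
have K0 : cone S 0.
  by exists 0%N, (fun=> 0), (fun=> 0); split=> [//|[]//|]; rewrite big_ord0.
suff [] : cone S (\sum_(i < k) c i *: s i) /\
    p (\sum_(i < k) c i *: s i) <= \sum_(i < k) c i * f (s i) by [].
apply: (big_ind2 (fun u b => cone S u /\ p u <= b)).
- by split=> //; rewrite -(scale0r 0) pZ // mul0r.
- move=> u b v d [Ku pu] [Kv pv]; split; first exact: coneD.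
  by rewrite (le_trans (pD _ _ Ku Kv)) // lerD.
- move=> i _; have Ki := sub_cone (Ss i); split; first exact: coneZ.
  by rewrite pZ // ler_wpM2l // pf.
Qed.

Lemma sublinear_envelope_exists S f : has_linear_minorant S f ->
  is_sublinear_envelope S f (sconv S f).
Proof.
move=> [l lf]; rewrite /sconv; apply: xgetPex.
have lm : sublinear_minorant S f l.
  by do 2!split=> //; move=> *; rewrite ?linearZ ?linearD.
pose A x := [set p x | p in sublinear_minorant S f].
have A0 x : A x !=set0 by exists (l x), l.
have Aub x : cone S x -> has_ubound (A x).
  by move=> /(@sublinear_minorant_bounded S f)[b hb]; exists b => _ [p pm <-]; apply: hb.
have leA p x : sublinear_minorant S f p -> cone S x -> p x <= sup (A x).
  by move=> pm Kx; apply: ub_le_sup; [exact: Aub|exists p].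
have leZ (r : R) x : 0 <= r -> cone S x -> sup (A (r *: x)) <= r * sup (A x).
  move=> r0 Kx; apply: ge_sup => // _ [p pm <-].
  have [[pZ _] _] := pm; rewrite pZ //.
  by rewrite ler_wpM2l // leA.
exists (fun x => sup (A x)); split; last by move=> q qm x; exact: leA.
split; [split|].
- move=> r x r0 Kx; apply/eqP; rewrite eq_le leZ //=.
  have [->|rN0] := eqVneq r 0.
    rewrite mul0r scale0r (le_trans _ (leA _ _ lm _)) ?linear0 //.
    by rewrite -(scale0r x); exact: coneZ.
  have {rN0}r0 : 0 < r by rewrite lt_neqAle eq_sym rN0.
  rewrite -ler_pdivlMl //.
  have := leZ r^-1 (r *: x).
  rewrite scalerA mulVf ?gt_eqF // scale1r; apply; first by rewrite invr_ge0 ltW.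
  by apply: coneZ => //; exact: ltW.
- move=> x y Kx Ky; apply: ge_sup => // _ [p pm <-].
  have [[_ pD] _] := pm.
  by rewrite (le_trans (pD _ _ Kx Ky)) // lerD // leA.
- by move=> x Sx; apply: ge_sup => // _ [p [_ pf] <-]; exact: pf.
Qed.

End Defs.

(* Main.v *)
Require Import Defs.
From HB Require Import structures.
From mathcomp Require Import all_boot all_order all_algebra all_fingroup.
From mathcomp Require Import all_classical all_reals.
Set Implicit Arguments.
Unset Strict Implicit.
Unset Printing Implicit Defensive.
Import Order.TTheory GRing.Theory Num.Theory.
Local Open Scope classical_set_scope.
Local Open Scope ring_scope.

(** The envelope is squeezed between the two sides of a linear programming
    duality, and the greedy vector [mu] solves both.

    Identify 0/1 vectors with subsets of ['I_n] and write m(A) for the sum of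
    the coordinates of [mu] over A.  Everything rests on [g] being
    intersecting submodular on [X]: the submodular inequality holds for two
    members of [X] that meet, and their union and intersection are again in
    [X] ([gfun_intersecting]).  Adding the singletons to the lattice family and
    lowering the values there is harmless, because a singleton that meets a
    set is contained in it, and for nested sets the inequality is an equality.
    Since every set feasible at step t contains [sigma t], this also makes each
    step of the recursion a submodular minimization over a lattice family.

    Lower bound ([mu_minorant]).  If A in [X] is nonempty with last element
    [sigma t], then removing [sigma t] from A leaves a candidate of step t, and
    minimality there says exactly m(A) <= g(A) ([mu_le]); for the empty set,
    g >= 0 comes from the linear minorant of [f] ([dot_mu_le]).  The inequalities of [g] on [X] imply
    those of [f] on the whole cube: the singletons give [mu <= a], hence
    m(A) <= f1(A) for all A ([dot_le_minf]).  So the linear function given by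
    [mu] is a sublinear minorant of [f].

    Upper bound ([minorant_le_mu]).  Call A in [X] tight when m(A) = g(A).  The
    minimizer of step t, together with [sigma t], is a tight subset of the first
    t + 1 elements that contains [sigma t].  By the usual uncrossing argument
    the union of two tight sets that meet is tight ([tightU]), so the maximal
    tight subsets of a prefix of the order [sigma] partition that prefix
    ([tight_partition]).  As [xbar] is a nonnegative combination of prefixes
    ([layer_cake]), it is a nonnegative combination of tight sets.  On such a
    set any sublinear minorant p of [f] satisfies p <= f <= g = m, so p is at
    most the value of [mu] at [xbar]. *)

(** * Uncrossing tight sets *)

Section IntersectingFamilies.
Context {R : numDomainType} {T : finType}.
Implicit Types (A B W : {set T}) (D : {set {set T}}) (G : {set T} -> R).

Definition intersecting_submodular D G : Prop :=
  forall A B, A \in D -> B \in D -> A :&: B != finset.set0 ->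
    [/\ A :|: B \in D, A :&: B \in D & G (A :|: B) + G (A :&: B) <= G A + G B].

Definition tight D G (m : T -> R) A : bool :=
  (A \in D) && (G A == \sum_(i in A) m i).

Lemma sum_setUI (m : T -> R) A B :
  \sum_(i in A :|: B) m i + \sum_(i in A :&: B) m i =
  \sum_(i in A) m i + \sum_(i in B) m i.
Proof.
rewrite !(big_mkcond (fun i => i \in _)) -!big_split /=.
apply: eq_bigr => i _; rewrite !inE.
by case: (i \in A); case: (i \in B); rewrite ?addr0 ?add0r.
Qed.

(** The slacks [G C - m C] of the union and of the intersection are nonnegative
    and add up to at most the slacks of [A] and [B], which vanish. *)
Lemma tightU D G m A B : intersecting_submodular D G ->
    (forall C, C \in D -> \sum_(i in C) m i <= G C) ->
    tight D G m A -> tight D G m B -> A :&: B != finset.set0 ->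
  tight D G m (A :|: B).
Proof.
move=> subG mG /andP[DA /eqP GA] /andP[DB /eqP GB] AB0.
have [DU DI] := subG A B DA DB AB0; rewrite GA GB -sum_setUI => GUI.
rewrite /tight DU eq_le mG // andbT.
by rewrite -(lerD2r (\sum_(i in A :&: B) m i)) (le_trans _ GUI) // lerD2l mG.
Qed.

(** The blocks are the maximal tight subsets of [W]: two of them that meet both
    equal their union, which is tight. *)
Lemma tight_partition D G m W : intersecting_submodular D G ->
    (forall C, C \in D -> \sum_(i in C) m i <= G C) ->
    (forall i, i \in W ->
       exists A, [/\ tight D G m A, i \in A & A \subset W]) ->
  exists2 P : {set {set T}},
    finset.partition P W & {in P, forall A, tight D G m A}.
Proof.
move=> subG mG covW.
pose Q B := [&& tight D G m B, B \subset W & B != finset.set0].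
pose P := [set A | maxset Q A]%SET.
have QP A : A \in P -> Q A by rewrite inE => /maxsetp.
exists P; last by move=> A /QP/and3P[].
apply/and3P; split; last by apply/negP => /QP/and3P[_ _]; rewrite eqxx.
- rewrite finset.eqEsubset; apply/andP; split.
    by apply/bigcupsP => A /QP/and3P[].
  apply/fintype.subsetP => i /covW[A [tA iA AW]].
  have /maxset_exists[B maxB AB] : Q A.
    by rewrite /Q tA AW; apply/finset.set0Pn; exists i.
  by apply/bigcupP; exists B; rewrite ?inE // (fintype.subsetP AB).
- apply/finset.trivIsetP => A B PA PB; apply: contraNT; rewrite -setI_eq0 => AB0.
  have /and3P[tA AW A0] := QP _ PA; have /and3P[tB BW B0] := QP _ PB.
  have QU : Q (A :|: B).
    rewrite /Q (tightU subG mG tA tB AB0) finset.subUset AW BW /=.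
    by apply: contraNneq A0 => U0; rewrite -finset.subset0 -U0 finset.subsetUl.
  move: PA PB; rewrite !inE => /maxsetP[_ maxA] /maxsetP[_ maxB].
  by rewrite -{1}(maxA _ QU (finset.subsetUl _ _)) (maxB _ QU (finset.subsetUr _ _)).
Qed.

End IntersectingFamilies.

(** * Subsets as 0/1 vectors *)

Section Indicators.
Context {R : realType} {n : nat}.
Implicit Types (A B : {set 'I_n}) (b u v x : 'rV[R]_n).

Definition ind A : 'rV[R]_n := \row_i (i \in A)%:R.

Lemma ind_cube A : cube (ind A).
Proof. by move=> i; rewrite mxE; case: (i \in A); [right|left]. Qed.

Lemma cube_ind x : cube x -> exists A, x = ind A.
Proof.
move=> cx; exists [set i | x 0 i == 1]%SET; apply/rowP => i; rewrite !mxE inE.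
by have [->|->] := cx i; rewrite ?eqxx // eq_sym oner_eq0.
Qed.

Lemma ind_inj : injective ind.
Proof.
move=> A B /rowP eAB; apply/setP => i; move: (eAB i); rewrite !mxE.
by case: (i \in A); case: (i \in B) => // /eqP; rewrite ?oner_eq0 // eq_sym oner_eq0.
Qed.

Lemma vle_ind A B : vle (ind A) (ind B) <-> A \subset B.
Proof.
split=> [AB|/fintype.subsetP AB i]; last first.
  by rewrite !mxE ler_nat; case: (boolP (i \in A)) => // /AB ->.
apply/fintype.subsetP => i iA; have := AB i; rewrite !mxE iA.
by case: (i \in B) => //; rewrite ler10.
Qed.

Lemma vjoin_ind A B : vjoin (ind A) (ind B) = ind (A :|: B).
Proof.
apply/rowP => i; rewrite !mxE inE; case: (i \in A); case: (i \in B);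
  by rewrite ?maxxx // ?(max_l ler01) ?(max_r ler01).
Qed.

Lemma vmeet_ind A B : vmeet (ind A) (ind B) = ind (A :&: B).
Proof.
apply/rowP => i; rewrite !mxE inE; case: (i \in A); case: (i \in B);
  by rewrite ?minxx // ?(min_l ler01) ?(min_r ler01).
Qed.

Lemma unitvec_ind i : unitvec i = ind [set i]%SET.
Proof. by apply/rowP => j; rewrite !mxE inE eqxx. Qed.

Lemma ind0 : ind finset.set0 = 0.
Proof. by apply/rowP => j; rewrite !mxE inE. Qed.

Lemma ind_setU1 i A : i \notin A -> ind (i |: A) = unitvec i + ind A.
Proof.
move=> iA; apply/rowP => j; rewrite !mxE !inE eqxx /=.
by case: eqVneq => [->|_]; rewrite ?(negbTE iA) ?addr0 ?add0r.
Qed.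

Lemma ind_sum A : ind A = \sum_(i in A) unitvec i.
Proof.
apply/rowP => j; rewrite summxE mxE.
under eq_bigr do rewrite mxE eqxx /= eq_sym.
have [jA|jA] := boolP (j \in A).
  by rewrite (bigD1 j) //= eqxx big1 ?addr0 // => i /andP[_ /negbTE->].
by rewrite big1 // => i iA; case: eqVneq => // ij; rewrite -ij iA in jA.
Qed.

Lemma ind_partition (P : {set {set 'I_n}}) A :
  finset.partition P A -> ind A = \sum_(B in P) ind B.
Proof.
move=> /and3P[/eqP <- tP _]; rewrite ind_sum big_trivIset //=.
by apply: eq_bigr => B _; rewrite ind_sum.
Qed.

Lemma dot_ind b A : dot b (ind A) = \sum_(i in A) b 0 i.
Proof.
rewrite /dot [RHS]big_mkcond; apply: eq_bigr => i _; rewrite mxE.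
by case: (i \in A); rewrite ?mulr1 ?mulr0.
Qed.

Lemma dotDr b u v : dot b (u + v) = dot b u + dot b v.
Proof. by rewrite /dot -big_split; apply: eq_bigr => i _; rewrite mxE mulrDr. Qed.

Lemma dotZr b (r : R) u : dot b (r *: u) = r * dot b u.
Proof. by rewrite /dot big_distrr; apply: eq_bigr => i _; rewrite mxE mulrCA. Qed.

End Indicators.

(** * Sublinear functions on conic combinations *)

Section ConicSums.
Context {R : realType} {n : nat}.
Variables (S : set 'rV[R]_n) (p : 'rV[R]_n -> R).
Hypothesis subp : sublinear_on (cone S) p.

Lemma cone0 : cone S 0.
Proof.
by exists 0%N, (fun=> 0), (fun=> 0); split=> [//|[]//|]; rewrite big_ord0.
Qed.

Lemma cone_sum (I : Type) (r : seq I) (P : pred I) (F : I -> 'rV[R]_n) :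
  (forall i, P i -> cone S (F i)) -> cone S (\sum_(i <- r | P i) F i).
Proof.
by move=> KF; apply: big_ind => //; [exact: cone0|exact: coneD].
Qed.

Lemma sublinear_sum_le (b : 'rV[R]_n) (I : Type) (r : seq I) (P : pred I)
    (F : I -> 'rV[R]_n) :
    (forall i, P i -> cone S (F i)) -> (forall i, P i -> p (F i) <= dot b (F i)) ->
  p (\sum_(i <- r | P i) F i) <= dot b (\sum_(i <- r | P i) F i).
Proof.
move=> KF pF; have [pZ pD] := subp.
suff [] : cone S (\sum_(i <- r | P i) F i) /\
    p (\sum_(i <- r | P i) F i) <= dot b (\sum_(i <- r | P i) F i) by [].
apply: (big_ind (fun u => cone S u /\ p u <= dot b u)).
- split; first exact: cone0.
  by rewrite -(scale0r 0) pZ ?dotZr ?mul0r //; exact: cone0.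
- move=> u v [Ku pu] [Kv pv]; split; first exact: coneD.
  by rewrite dotDr (le_trans (pD _ _ Ku Kv)) // lerD.
- by move=> i Pi; split; [exact: KF|exact: pF].
Qed.

End ConicSums.

(** * Prefixes of the sorting permutation *)

Section Prefixes.
Context {R : realType} {n : nat}.
Variable sigma : {perm 'I_n}.

Definition prefix (t : nat) : {set 'I_n} := [set i | (sigma^-1%g i < t)%N]%SET.

Lemma mem_prefix (s : 'I_n) t : (sigma s \in prefix t) = (s < t)%N.
Proof. by rewrite inE permK. Qed.

Lemma prefixS (t : 'I_n) : prefix t.+1 = sigma t |: prefix t.
Proof.
apply/setP => i; rewrite !inE ltnS leq_eqVlt; congr (_ || _).
by rewrite -{2}(permKV sigma i) (inj_eq perm_inj) (inj_eq val_inj).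
Qed.

Lemma prefix_out t : (n <= t)%N -> prefix t = finset.setT.
Proof. by move=> nt; apply/setP => i; rewrite !inE (leq_trans _ nt). Qed.

Lemma vsig_prefix t : vsig sigma t = ind (prefix t) :> 'rV[R]_n.
Proof.
elim: t => [|t IHt] /=.
  by apply/rowP => i; rewrite !mxE inE.
rewrite IHt; case: insubP => [i _ <-|]; last first.
  by rewrite -leqNgt => nt; rewrite addr0 !prefix_out ?leqW.
by rewrite prefixS ind_setU1 1?addrC // mem_prefix ltnn.
Qed.

(** The coefficients are the gaps between consecutive sorted entries, the last
    entry being compared with 0: the coordinate [sigma s] is the telescoping sum
    of the gaps from position [s] on. *)
Lemma layer_cake (x : 'rV[R]_n) :
    (forall i, 0 <= x 0 i) ->
    (forall i j : 'I_n, (i <= j)%N -> x 0 (sigma j) <= x 0 (sigma i)) ->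
  exists2 c : 'I_n -> R, forall t, 0 <= c t &
    x = \sum_(t < n) c t *: ind (prefix t.+1).
Proof.
move=> x_ge0 x_sorted.
(* The value 0 past the end provides the last gap. *)
pose d t := if insub t is Some i then x 0 (sigma i) else 0.
have dE (t : 'I_n) : d t = x 0 (sigma t) by rewrite /d valK.
exists (fun t : 'I_n => d t - d t.+1) => [t|].
  rewrite subr_ge0 dE /d; case: insubP => [j _ jt|_]; last exact: x_ge0.
  by apply: x_sorted; rewrite jt.
apply/rowP => j; rewrite summxE -(permKV sigma j); set s := (sigma^-1)%g j.
under eq_bigr do rewrite !mxE mem_prefix ltnS mulr_natr mulrb.
rewrite -big_mkcond /= -(big_geq_mkord s n xpredT (fun t => d t - d t.+1)).
rewrite (@telescope_sumr_eq _ _ _ (fun t => - d t)) ?(ltnW (ltn_ord s)) //.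
  by rewrite opprK dE /d insubF ?ltnn // oppr0 add0r.
by move=> t _; rewrite opprK addrC.
Qed.

End Prefixes.

(** * The greedy vector *)

Lemma minimumP {R : realType} (I : finType) (Q : pred I) (h : I -> R) (A : set R) :
    A = [set h i | i in [set i | Q i]] -> (exists i, Q i) ->
  is_minimum A (minimum A).
Proof.
move=> -> [i0 Qi0]; apply: (xgetPex 0).
case: (arg_minP h Qi0) => i Qi hi; exists (h i); split; first by exists i.
by move=> _ [j Qj <-]; exact: hi.
Qed.

Section Greedy.
Context {R : realType} {n : nat}.
Variables (X : set 'rV[R]_n) (g : 'rV[R]_n -> R) (sigma : {perm 'I_n}).
Hypothesis X_unit : forall i, X (unitvec i).
Local Notation m := (mu X g sigma).
Local Notation beta := (beta X g sigma).
Local Notation prefix := (prefix sigma).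
Implicit Types (t : 'I_n) (A B : {set 'I_n}).

Lemma mu_sigma t : m 0 (sigma t) = step_min X g sigma t (beta t).
Proof. by rewrite mxE permK. Qed.

(** [beta t] is [mu] truncated to the prefix, so that the objective of step [t]
    subtracts values of [mu] itself ([objective_ind]). *)
Lemma beta_mu (t : nat) i : beta t 0 i = if i \in prefix t then m 0 i else 0.
Proof.
elim: t => [|t IHt] /=; first by rewrite inE mxE.
rewrite mxE IHt; case: insubP => [s _ st|]; last first.
  by rewrite -leqNgt => nt; rewrite !mxE addr0 !prefix_out ?leqW.
rewrite -st prefixS -mu_sigma !mxE eqxx in_setU1 /=.
case: eqVneq => [->|_]; last by rewrite mulr0 addr0.
by rewrite mem_prefix ltnn mulr1 add0r.
Qed.

Lemma feasible_ind t B :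
  feasible X sigma t (ind B) <-> B \subset prefix t /\ X (ind (sigma t |: B)).
Proof.
have out : B \subset prefix t -> sigma t \notin B.
  by move=> /fintype.subsetP BP; apply/negP => /BP; rewrite mem_prefix ltnn.
split=> [[_]|[BP XB]].
  by rewrite vsig_prefix vle_ind => BP; rewrite ind_setU1 ?out.
split; first exact: ind_cube.
  by rewrite vsig_prefix vle_ind.
by rewrite -ind_setU1 ?out.
Qed.

Lemma objective_ind t B : B \subset prefix t ->
  objective g sigma t (beta t) (ind B) =
  g (ind (sigma t |: B)) - \sum_(i in B) m 0 i.
Proof.
move=> /fintype.subsetP BP; rewrite /objective ind_setU1; last first.
  by apply/negP => /BP; rewrite mem_prefix ltnn.
congr (_ - _); rewrite dot_ind; apply: eq_bigr => i iB.
by rewrite beta_mu BP.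
Qed.

Lemma mu_is_minimum t :
  is_minimum [set objective g sigma t (beta t) y | y in feasible X sigma t]
             (m 0 (sigma t)).
Proof.
rewrite mu_sigma.
apply: (@minimumP _ _ (fun B => `[< feasible X sigma t (ind B) >])
          (fun B => objective g sigma t (beta t) (ind B))); last first.
  exists finset.set0; apply/asboolP/feasible_ind.
  by rewrite finset.sub0set finset.setU0 -unitvec_ind.
apply/seteqP; split=> [_ [y Fy <-]|_ [B /asboolP FB <-]]; last by exists (ind B).
have [/cube_ind[B yB] _ _] := Fy.
by exists B; rewrite -?yB //; apply/asboolP; rewrite -yB.
Qed.

(** The witness is a minimizer of step [t]; the equality says that the minimum
    is attained there. *)
Lemma mu_tight t : exists B,
  [/\ B \subset prefix t, X (ind (sigma t |: B)) &
      g (ind (sigma t |: B)) = \sum_(i in sigma t |: B) m 0 i].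
Proof.
have [[y Fy +] _] := mu_is_minimum t.
have [/cube_ind[B yB] _ _] := Fy.
move: Fy; rewrite {y}yB => /feasible_ind[BP XB].
rewrite objective_ind // => e; exists B; split=> //.
rewrite big_setU1 /=; first by rewrite -e subrK.
by apply/negP => /(fintype.subsetP BP); rewrite mem_prefix ltnn.
Qed.

(** Removing from [A] its last element in the order [sigma] leaves a feasible
    point of the corresponding step, whose objective bounds [mu] there.  The
    empty set is excluded since it has no last element. *)
Lemma mu_le A : X (ind A) -> A != finset.set0 ->
  \sum_(i in A) m 0 i <= g (ind A).
Proof.
move=> XA /finset.set0Pn[i0 i0A].
have [i iA imax] := arg_maxnP (fun i => val ((sigma^-1)%g i)) i0A.
set t := (sigma^-1)%g i in imax; have it : i = sigma t by rewrite permKV.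
have {}imax j : j \in A -> ((sigma^-1)%g j <= t)%N := imax j.
have BP : A :\ i \subset prefix t.
  apply/fintype.subsetP => j; rewrite in_setD1 inE => /andP[ji jA].
  rewrite ltn_neqAle imax // andbT (inj_eq val_inj).
  by rewrite (inj_eq (@perm_inj _ sigma^-1%g)).
have AE : sigma t |: (A :\ i) = A by rewrite -it finset.setD1K.
have [_ /(_ (objective g sigma t (beta t) (ind (A :\ i))))] := mu_is_minimum t.
rewrite objective_ind // AE -it (big_setD1 i iA) /= lerBrDr; apply.
exists (ind (A :\ i)); last by rewrite objective_ind // AE.
by apply/feasible_ind; rewrite AE.
Qed.

Definition support_family : {set {set 'I_n}} := [set A | `[< X (ind A) >]]%SET.

Lemma mem_support_family A : (A \in support_family) = `[< X (ind A) >].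
Proof. by rewrite inE. Qed.

Hypothesis g_sub :
  intersecting_submodular support_family (fun A => g (ind A)).

(** Feasible points become members of [X] by adding [sigma t], which makes any
    two of them meet; the intersecting inequality thus applies without
    restriction. *)
Lemma feasible_UI t A B : A \subset prefix t -> B \subset prefix t ->
    X (ind (sigma t |: A)) -> X (ind (sigma t |: B)) ->
  [/\ X (ind (sigma t |: (A :|: B))), X (ind (sigma t |: (A :&: B))) &
      g (ind (sigma t |: (A :|: B))) + g (ind (sigma t |: (A :&: B))) <=
      g (ind (sigma t |: A)) + g (ind (sigma t |: B))].
Proof.
move=> AP BP XA XB.
have := @g_sub (sigma t |: A) (sigma t |: B).
rewrite !mem_support_family -finset.setUUr -finset.setUIr.
case; [exact/asboolP|exact/asboolP| |by move=> /asboolP ? /asboolP ?].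
by apply/finset.set0Pn; exists (sigma t); rewrite setU11.
Qed.

Lemma feasible_lattice t : lattice_family (feasible X sigma t).
Proof.
split=> [y []//|y z Fy Fz].
have [/cube_ind[A yA] _ _] := Fy; have [/cube_ind[B zB] _ _] := Fz.
move: Fy Fz; rewrite {y}yA {z}zB => /feasible_ind[AP XA] /feasible_ind[BP XB].
have [XU XI _] := feasible_UI AP BP XA XB.
rewrite vjoin_ind vmeet_ind; split; apply/feasible_ind; split=> //.
  by rewrite finset.subUset AP.
by rewrite (fintype.subset_trans (finset.subsetIl _ _)).
Qed.

(** The subtracted term is modular, so submodularity is inherited from [g]. *)
Lemma objective_submodular t :
  submodular_on (feasible X sigma t) (EFin \o objective g sigma t (beta t)).
Proof.
move=> y z Fy Fz.
have [/cube_ind[A yA] _ _] := Fy; have [/cube_ind[B zB] _ _] := Fz.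
move: Fy Fz; rewrite {y}yA {z}zB => /feasible_ind[AP XA] /feasible_ind[BP XB].
have [_ _ gUI] := feasible_UI AP BP XA XB.
rewrite vjoin_ind vmeet_ind /= -!EFinD lee_fin.
rewrite !objective_ind ?finset.subUset ?AP //; last first.
  exact: fintype.subset_trans (finset.subsetIl _ _) AP.
by rewrite addrACA [leRHS]addrACA -!opprD sum_setUI lerD2r.
Qed.

End Greedy.

(** * The minimum of a linear and a submodular function *)

Section MinOfTwo.
Context {R : realType} {n : nat}.
Variables (a : 'rV[R]_n) (f2 : 'rV[R]_n -> \bar R) (L : set 'rV[R]_n).
Hypothesis HL : lattice_family L.
Hypothesis Hfin : forall x, L x -> f2 x \is a fin_num.
Hypothesis Hsub : submodular_on L f2.
Hypothesis Hinf : forall x, cube x -> ~ L x -> f2 x = +oo%E.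
Local Notation f := (minf a f2).
Local Notation g := (gfun a f2).
Local Notation X := (Xset L).

Lemma Xset_unit i : X (unitvec i).
Proof. by right; exists i. Qed.

Lemma Xset_cube x : X x -> cube x.
Proof.
case=> [/(HL.1)//|[i _ <-]]; rewrite unitvec_ind; exact: ind_cube.
Qed.

Lemma minf_in x : L x -> f x = Num.min (dot a x) (fine (f2 x)).
Proof. by move=> /Hfin Lx; rewrite /minf -{1}(fineK Lx) -EFin_min. Qed.

Lemma minf_out x : cube x -> ~ L x -> f x = dot a x.
Proof. by move=> cx Lx; rewrite /minf Hinf // min_l // leey. Qed.

Lemma minf_le_dot x : cube x -> f x <= dot a x.
Proof.
move=> cx; have [Lx|Lx] := pselect (L x); last by rewrite minf_out.
by rewrite minf_in // ge_min lexx.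
Qed.

Lemma gfun_unit i : g (unitvec i) = f (unitvec i).
Proof. by rewrite /gfun; case: existsP => // -[]; exists i. Qed.

Lemma gfun_nonunit x : (forall i, x <> unitvec i) -> g x = fine (f2 x).
Proof. by move=> xN; rewrite /gfun; case: existsP => // -[i /eqP /xN]. Qed.

Lemma gfun_le x : L x -> g x <= fine (f2 x).
Proof.
move=> Lx; rewrite /gfun; case: ifP => // _.
by rewrite -/(f x) minf_in // ge_min lexx orbT.
Qed.

Lemma minf_le_gfun x : X x -> f x <= g x.
Proof.
case=> [Lx|[i _ <-]]; last by rewrite gfun_unit.
rewrite /gfun; case: ifP => // _.
by rewrite minf_in // ge_min lexx orbT.
Qed.

Lemma dot_unitvec (b : 'rV[R]_n) i : dot b (unitvec i) = b 0 i.
Proof. by rewrite unitvec_ind dot_ind finset.big_set1. Qed.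

(** The inequalities at the unit vectors bound [b] by [a] coordinatewise, which
    takes care of the linear part on all of the cube, also outside [L]. *)
Lemma dot_le_minf (b x : 'rV[R]_n) :
  (forall z, X z -> dot b z <= g z) -> cube x -> dot b x <= f x.
Proof.
move=> bg cx.
have ba : dot b x <= dot a x.
  apply: ler_sum => i _; apply: ler_wpM2r; first by case: (cx i) => ->.
  rewrite -!dot_unitvec (le_trans (bg _ (Xset_unit i))) // gfun_unit.
  by apply: minf_le_dot; apply: Xset_cube; exact: Xset_unit.
have [Lx|Lx] := pselect (L x); last by rewrite minf_out.
rewrite minf_in // le_min ba (le_trans (bg x _)) //; first by left.
exact: gfun_le.
Qed.

(** For comparable sets the inequality is an equality.  Two incomparable sets
    that meet are not singletons, so they lie in [L], where [g] is [f2]; at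
    their union and intersection [g] can only be smaller than [f2]. *)
Lemma gfun_intersecting :
  intersecting_submodular (support_family X) (fun A => g (ind A)).
Proof.
suff comparable A B : A \in support_family X -> B \in support_family X ->
    A \subset B -> [/\ A :|: B \in support_family X,
      A :&: B \in support_family X &
      g (ind (A :|: B)) + g (ind (A :&: B)) <= g (ind A) + g (ind B)].
  move=> A B DA DB AB0.
  have [AB|AB] := boolP (A \subset B); first exact: comparable.
  have [BA|BA] := boolP (B \subset A).
    by rewrite finset.setUC finset.setIC (addrC (g (ind A))); apply: comparable.
  have nonunit C C' i : C :&: C' != finset.set0 -> ~~ (C \subset C') ->
      ind C <> unitvec i :> 'rV[R]_n.
    move=> CC' CnC'; rewrite unitvec_ind => /ind_inj Ci.
    move: CC' CnC'; rewrite {C}Ci finset.sub1set => /finset.set0Pn[j].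
    by rewrite !inE => /andP[/eqP->->].
  have inL C C' : C \in support_family X -> C :&: C' != finset.set0 ->
      ~~ (C \subset C') -> L (ind C).
    rewrite mem_support_family => /asboolP[//|[i _ e]] CC' CnC'.
    by case: (nonunit C C' i).
  have LA := inL _ _ DA AB0 AB.
  have LB : L (ind B) by apply: inL DB _ BA; rewrite finset.setIC.
  have [LU LI] := HL.2 _ _ LA LB; rewrite vjoin_ind vmeet_ind in LU LI.
  split; [by rewrite mem_support_family; apply/asboolP; left..|].
  rewrite (le_trans (lerD (gfun_le LU) (gfun_le LI))) //.
  rewrite !gfun_nonunit; try by move=> i; apply: nonunit AB.
    have := Hsub LA LB; rewrite vjoin_ind vmeet_ind.
    by rewrite -lee_fin !EFinD !fineK ?Hfin.
  by move=> i; apply: nonunit BA; rewrite finset.setIC.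
move=> DA DB AB; rewrite (finset.setUidPr AB) (finset.setIidPl AB).
by split=> //; rewrite addrC.
Qed.

(** * The sublinear envelope *)

Section Envelope.
Variables (xbar : 'rV[R]_n) (sigma : {perm 'I_n}).
Hypothesis Hlin : has_linear_minorant cube f.
Hypothesis Hxbar : forall i, 0 <= xbar 0 i.
Hypothesis Hsigma : forall i j : 'I_n, (i <= j)%N ->
  xbar 0 (sigma j) <= xbar 0 (sigma i).
Local Notation m := (mu X g sigma).

(** At the origin no step of the recursion bounds anything; there the linear
    minorant of [f], which vanishes, forces [0 <= g 0]. *)
Lemma dot_mu_le A : X (ind A) -> dot m (ind A) <= g (ind A).
Proof.
have [->|A0 XA] := eqVneq A finset.set0; last first.
  by rewrite dot_ind; apply: mu_le => //; exact: Xset_unit.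
move=> X0; apply: le_trans (minf_le_gfun X0).
rewrite dot_ind finset.big_set0 ind0.
by have [l /(_ (ind finset.set0) (ind_cube _))] := Hlin; rewrite ind0 linear0.
Qed.

Lemma mu_minorant : sublinear_minorant cube f (dot m).
Proof.
split; first by split=> [r x _ _|x y _ _]; rewrite ?dotZr ?dotDr.
move=> x; apply: dot_le_minf => z Xz.
have [A zA] := cube_ind (Xset_cube Xz); rewrite zA in Xz *.
exact: dot_mu_le.
Qed.

(** Each element of a prefix lies in the tight set produced by its own step,
    which contains no later elements. *)
Lemma prefix_partition t : exists2 P : {set {set 'I_n}},
  finset.partition P (prefix sigma t) &
  {in P, forall A, X (ind A) /\ g (ind A) = dot m (ind A)}.
Proof.
have feas C : C \in support_family X -> \sum_(i in C) m 0 i <= g (ind C).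
  by rewrite mem_support_family -dot_ind => /asboolP; exact: dot_mu_le.
have [|P PW tP] := tight_partition (W := prefix sigma t) gfun_intersecting feas.
  move=> i; rewrite inE => it; set s := (sigma^-1)%g i in it.
  have [B [BP XB gB]] := mu_tight g sigma Xset_unit s.
  exists (sigma s |: B); split.
  - by rewrite /tight mem_support_family gB eqxx andbT; apply/asboolP.
  - by rewrite -[i](permKV sigma) setU11.
  apply: (@fintype.subset_trans _ _ (prefix sigma s.+1)).
    by rewrite prefixS finset.setUS.
  by apply/fintype.subsetP => j; rewrite !inE => /leq_trans->.
exists P => // A /tP/andP[]; rewrite mem_support_family dot_ind.
by move=> /asboolP XA /eqP.
Qed.

Lemma minorant_le_mu p : sublinear_minorant cube f p -> p xbar <= dot m xbar.
Proof.
move=> [subp pf]; have [pZ _] := subp.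
have [c c_ge0 ->] := layer_cake Hxbar Hsigma.
have Kind A : cone cube (ind A : 'rV[R]_n) by apply: sub_cone; exact: ind_cube.
apply: (sublinear_sum_le subp) => [t _|t _]; first exact: coneZ.
rewrite pZ // dotZr ler_wpM2l //.
have [P PW tP] := prefix_partition t.+1.
rewrite (ind_partition PW).
apply: (sublinear_sum_le subp) => // A PA; have [XA <-] := tP _ PA.
by rewrite (le_trans (pf _ (ind_cube A))) // minf_le_gfun.
Qed.

Lemma sconv_eq_mu : sconv cube f xbar = dot m xbar.
Proof.
have [sm smax] := sublinear_envelope_exists Hlin.
apply/eqP; rewrite eq_le minorant_le_mu // smax //; first exact: mu_minorant.
have [c c_ge0 ->] := layer_cake Hxbar Hsigma.
by apply: cone_sum => t _; apply: coneZ => //; apply: sub_cone; exact: ind_cube.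
Qed.

End Envelope.
End MinOfTwo.

Theorem theorem4 (R : realType) (n : nat)
    (a : 'rV[R]_n) (f2 : 'rV[R]_n -> \bar R) (L : set 'rV[R]_n)
    (HL : lattice_family L)
    (Hfin : forall x, L x -> f2 x \is a fin_num)
    (Hsub : submodular_on L f2)
    (Hinf : forall x, cube x -> ~ L x -> f2 x = +oo%E)
    (Hlin : has_linear_minorant cube (minf a f2))
    (xbar : 'rV[R]_n) (Hxbar : forall i, 0 <= xbar 0 i)
    (sigma : {perm 'I_n})
    (Hsigma : forall i j : 'I_n, (i <= j)%N ->
       xbar 0 (sigma j) <= xbar 0 (sigma i)) :
  let X := Xset L in
  let g := gfun a f2 in
  let m := mu X g sigma in
  sconv cube (minf a f2) xbar = dot m xbar /\
  forall t : 'I_n,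
    let F := feasible X sigma t in
    let obj := objective g sigma t (beta X g sigma t) in
    [/\ lattice_family F,
        submodular_on F (EFin \o obj) &
        is_minimum [set obj y | y in F] (m 0 (sigma t))].
Proof.
move=> X g m; split; first exact: sconv_eq_mu.
have g_sub : intersecting_submodular (support_family X) (fun A => g (ind A)).
  exact: gfun_intersecting.
move=> t F obj; split.
- exact: feasible_lattice g_sub t.
- exact: objective_submodular g_sub t.
- by apply: mu_is_minimum; exact: Xset_unit.
Qed.
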